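(* Let $A$ be a $C^*$-algebra, let $V$ be a Hilbert $A$-module, and let $(W,B,\Phi)$ be an essential extension of $V$. Then this extension is automatically strictly essential, i.e. $$\|b\|=\sup\{\|ba\|: a\in A,\|a\|\le 1\}\quad\text{for all } b\in B$$ and $$\|y\|=\sup\{\|ya\|: a\in A,\|a\|\le 1\}\quad\text{for all } y\in W.$$
   Context: Hilbert modules are right modules, with norm $\|x\|=\|\langle x,x\rangle\|^{1/2}$ and inner product linear in the second variable. An extension of a Hilbert $A$-module $V$ is a triple $(W,B,\Phi)$ such that: (1) $B$ is a $C^*$-algebra and $A\subset B$ is an ideal; (2) $W$ is a Hilbert $B$-module; (3) $\Phi:V\to W$ is a map satisfying $\langle\Phi x,\Phi y\rangle=\langle x,y\rangle$ for all $x,y\in V$; (4) $\mathrm{Im}\,\Phi=WA$, where $WA$ is the closed linear span of $\{ya: y\in W,a\in A\}$. The extension is called essential if in addition $A$ is an essential ideal of $B$. *)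

(* Defs.v *)
From HB Require Import structures.
From mathcomp Require Import all_boot all_order all_algebra.
From mathcomp Require Import complex.
From mathcomp Require Import all_classical all_reals all_analysis.
Set Implicit Arguments.
Unset Strict Implicit.
Unset Printing Implicit Defensive.
Import Order.TTheory GRing.Theory Num.Theory.
Import numFieldNormedType.Exports.
Local Open Scope classical_set_scope.
Local Open Scope complex_scope.
Local Open Scope ring_scope.

(* C*-algebras need not have a unit, so the product is not the one of a
   MathComp ring structure. *)
HB.mixin Record CompleteNormedModule_isCStarAlgebra (R : realType) A
    of CompleteNormedModule R[i] A := {
  cmul : A -> A -> A ;
  cstar : A -> A ;
  cmulA : associative cmul ;
  cmulDl : left_distributive cmul +%R ;
  cmulDr : right_distributive cmul +%R ;
  cscaleAl : forall (c : R[i]) (a b : A), c *: cmul a b = cmul (c *: a) b ;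
  cscaleAr : forall (c : R[i]) (a b : A), c *: cmul a b = cmul a (c *: b) ;
  cstarK : involutive cstar ;
  cstarD : {morph cstar : a b / a + b} ;
  cstarZ : forall (c : R[i]) (a : A), cstar (c *: a) = c^* *: cstar a ;
  cstarM : forall a b : A, cstar (cmul a b) = cmul (cstar b) (cstar a) ;
  cnormM : forall a b : A, `|cmul a b| <= `|a| * `|b| ;
  cnorm_star_mul : forall a : A, `|cmul (cstar a) a| = `|a| ^+ 2
}.

#[short(type="cstarAlgType")]
HB.structure Definition CStarAlgebra (R : realType) :=
  {A of CompleteNormedModule_isCStarAlgebra R A & CompleteNormedModule R[i] A}.

Definition cpositive (R : realType) (A : cstarAlgType R) (a : A) : Prop :=
  exists b : A, a = cmul (cstar b) b.

(* Right Hilbert A-modules; [ract x a] is the module action x a and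
   [hdot x y] is the A-valued inner product <x, y>. *)
HB.mixin Record CompleteNormedModule_isHilbertModule (R : realType)
    (A : cstarAlgType R) V of CompleteNormedModule R[i] V := {
  ract : V -> A -> V ;
  hdot : V -> V -> A ;
  ractDl : forall (x y : V) (a : A), ract (x + y) a = ract x a + ract y a ;
  ractDr : forall (x : V) (a b : A), ract x (a + b) = ract x a + ract x b ;
  ractM : forall (x : V) (a b : A), ract x (cmul a b) = ract (ract x a) b ;
  ractZl : forall (c : R[i]) (x : V) (a : A),
    ract (c *: x) a = c *: ract x a ;
  ractZr : forall (c : R[i]) (x : V) (a : A),
    ract x (c *: a) = c *: ract x a ;
  hdotDr : forall x y z : V, hdot x (y + z) = hdot x y + hdot x z ;
  hdotZr : forall (c : R[i]) (x y : V), hdot x (c *: y) = c *: hdot x y ;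
  hdot_ract : forall (x y : V) (a : A),
    hdot x (ract y a) = cmul (hdot x y) a ;
  hdot_star : forall x y : V, cstar (hdot x y) = hdot y x ;
  hdot_ge0 : forall x : V, cpositive (hdot x x) ;
  hdot_eq0 : forall x : V, hdot x x = 0 -> x = 0 ;
  hnormE : forall x : V, `|x| = sqrtC `|hdot x x|
}.

#[short(type="hilbertModType")]
HB.structure Definition HilbertModule (R : realType) (A : cstarAlgType R) :=
  {V of CompleteNormedModule_isHilbertModule R A V
      & CompleteNormedModule R[i] V}.

(* Norms over R[i] take values in R[i]; this is the same norm, read in R. *)
Definition rnorm (R : realType) (V : normedModType R[i]) (x : V) : R :=
  complex.Re `|x|.

Definition closed_span (R : realType) (V : normedModType R[i]) (S : set V) :
    set V :=
  closure [set x : V | exists (n : nat) (c : 'I_n -> R[i]) (v : 'I_n -> V),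
    (forall i, S (v i)) /\ x = \sum_(i < n) c i *: v i].

Record closed_ideal (R : realType) (B : cstarAlgType R) (J : set B) : Prop := {
  closed_ideal0 : J 0 ;
  closed_idealD : forall a b, J a -> J b -> J (a + b) ;
  closed_idealZ : forall (c : R[i]) a, J a -> J (c *: a) ;
  closed_idealMl : forall b a, J a -> J (cmul b a) ;
  closed_idealMr : forall a b, J a -> J (cmul a b) ;
  closed_ideal_closed : closed J
}.

Definition essential_ideal (R : realType) (B : cstarAlgType R) (I : set B) :
    Prop :=
  closed_ideal I /\
  forall J : set B, closed_ideal J -> J != [set 0] -> I `&` J != [set 0].

(* [iota] identifies A with a C*-subalgebra of B. *)
Record cstar_inclusion (R : realType) (A B : cstarAlgType R)
    (iota : A -> B) : Prop := {
  inclusionP : linear iota ;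
  inclusionM : forall a b, iota (cmul a b) = cmul (iota a) (iota b) ;
  inclusion_star : forall a, iota (cstar a) = cstar (iota a) ;
  inclusion_norm : forall a, `|iota a| = `|a|
}.

(* The extension (W, B, Phi) of V, where A is viewed inside B through iota.
   Phi is an arbitrary map: its linearity is not assumed. *)
Record is_extension (R : realType) (A B : cstarAlgType R) (iota : A -> B)
    (V : hilbertModType A) (W : hilbertModType B) (Phi : V -> W) : Prop := {
  extension_incl : cstar_inclusion iota ;
  extension_ideal : closed_ideal (range iota) ;
  extension_hdot : forall x y, hdot (Phi x) (Phi y) = iota (hdot x y) ;
  extension_range : range Phi =
    closed_span [set z : W | exists (y : W) (a : A), z = ract y (iota a)]
}.

Definition is_essential_extension (R : realType) (A B : cstarAlgType R)
    (iota : A -> B) (V : hilbertModType A) (W : hilbertModType B)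
    (Phi : V -> W) : Prop :=
  is_extension iota Phi /\ essential_ideal (range iota).

(* Main.v *)
Require Import Defs.
From HB Require Import structures.
From mathcomp Require Import all_boot all_order all_algebra.
From mathcomp Require Import complex.
From mathcomp Require Import all_classical all_reals all_analysis.
From mathcomp Require Import ring lra.
Set Implicit Arguments.
Unset Strict Implicit.
Unset Printing Implicit Defensive.
Import Order.TTheory GRing.Theory Num.Theory.
Import numFieldNormedType.Exports.
Local Open Scope classical_set_scope.
Local Open Scope ring_scope.

(**
Write p(b) for the supremum of ||ba|| over the unit ball of A. It is clear that
p(b) <= ||b||, and p(b) = 0 forces b = 0 because the left annihilator of an
essential ideal vanishes ([essential_ideal_faithful]). The point is that p
cannot be strictly smaller than the norm. This is the usual statement that an
injective *-homomorphism (here B acting on A by multiplication) is isometric;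
the proof below replaces the functional calculus by one explicit function,
built from square roots.

By the C*-identity, applied to b* b, it suffices to compare the two norms on
squares of self-adjoint elements, and after scaling one may suppose that
b = 2 c^2 with c = c*, ||c|| <= 1 and p(b) < 1 < ||b||. In the unitization put
y = 1 - |1 - b|. The spectrum of b lies in [0, 2], where 1 - |1 - t| is at most
1, and coincides with t on [0, 1]; so b and y must agree as seen by p, whereas
||y|| <= 1 < ||b||. Concretely (1 - y)^2 = (1 - b)^2 with y and b commuting,
that is (b - y)(2 - y - b) = 0. Since p(y + b) < 2, the factor 2 - y - b is
invertible as seen by A, so b - y annihilates A and b = y: a contradiction
([cutoff_rnorm_le1]).

All of this can be said without a unit. The element y is a root of
2 y = x + y^2 with x = 2 b - b^2, and such a root with ||y|| <= 1 exists as soon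
as ||x|| <= 1 ([exists_quadratic_root]). With c the sine of an angle, x is the
squared sine of the doubled angle, and ||x|| <= 1 follows from the fact that the
unitary with imaginary part c acts isometrically ([rnorm_double_angle]).

For a module element y, positivity gives <y, y> = c* c, hence ||y|| = ||c|| and
||ya|| = ||ca|| for all a ([hilbert_norm_by_algebra]), and the second formula is
the first one for c.
*)

(** * Real-valued norms and convergence *)

Section RealNorm.
Context {R : realType} {V : normedModType R[i]}.
Implicit Types (x y : V) (r : R).

Lemma normE_rnorm x : `|x| = (rnorm x)%:C%C.
Proof. by apply/esym/RRe_real/ger0_real. Qed.

Lemma rnorm_ge0 x : 0 <= rnorm x.
Proof. by rewrite -lecR -normE_rnorm normr_ge0. Qed.

Lemma rnorm0 : rnorm (0 : V) = 0.
Proof. by rewrite /rnorm normr0. Qed.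

Lemma rnorm0_eq0 x : rnorm x = 0 -> x = 0.
Proof. by move=> x0; apply/normr0_eq0; rewrite normE_rnorm x0. Qed.

Lemma rnormN x : rnorm (- x) = rnorm x.
Proof. by rewrite /rnorm normrN. Qed.

Lemma ler_rnormD x y : rnorm (x + y) <= rnorm x + rnorm y.
Proof. by rewrite -lecR rmorphD /= -!normE_rnorm ler_normD. Qed.

Lemma ler_rnormB x y : rnorm (x - y) <= rnorm x + rnorm y.
Proof. by rewrite -(rnormN y) ler_rnormD. Qed.

Lemma rnormZ (c : R[i]) x : rnorm (c *: x) = complex.Re `|c| * rnorm x.
Proof.
apply: complexI; rewrite rmorphM /= -!normE_rnorm normrZ.
by congr (_ * _); apply/esym/RRe_real/ger0_real.
Qed.

Lemma rnormZr r x : 0 <= r -> rnorm (r%:C%C *: x) = r * rnorm x.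
Proof. by move=> r0; rewrite rnormZ ger0_norm // ler0c. Qed.

Lemma rnormMn x n : rnorm (x *+ n) = rnorm x *+ n.
Proof. by rewrite /rnorm normrMn raddfMn. Qed.

Lemma rnormZi x : rnorm ('i%C *: x) = rnorm x.
Proof. by rewrite rnormZ normc_def /= expr0n expr1n add0r sqrtr1 mul1r. Qed.

Lemma rnorm_cvgP (u : nat -> V) x :
  u @ \oo --> x ->
  forall e, 0 < e -> exists N, forall n, (N <= n)%N -> rnorm (x - u n) < e.
Proof.
move=> /cvgrPdist_lt ux e e0.
have /ux[N _ uN] : 0 < e%:C%C by rewrite ltcR.
exists N => n Nn; rewrite -ltcR -normE_rnorm; exact: uN.
Qed.

End RealNorm.

Lemma closed_bounded_kernel (R : realType) (U V : normedModType R[i])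
    (f : U -> V) (K : R) :
  {morph f : x y / x - y} -> (forall x, rnorm (f x) <= K * rnorm x) ->
  closed [set x | f x = 0].
Proof.
move=> fB fK x clx; apply: rnorm0_eq0; apply/eqP.
rewrite eq_le rnorm_ge0 andbT; apply/ler_addgt0Pr => e e0; rewrite add0r.
have d0 : 0 < e / (`|K| + 1) by rewrite divr_gt0// ltr_wpDl.
have /clx[y [/= fy0]] : nbhs x (ball x (e / (`|K| + 1))%:C%C).
  by apply: nbhsx_ballx; rewrite ltcR.
rewrite -ball_normE /= normE_rnorm ltcR => xy.
rewrite -[f x]subr0 -fy0 -fB (le_trans (fK _))//.
rewrite ltr_pdivlMr ?ltr_wpDl// in xy.
rewrite (le_trans _ (ltW xy))// mulrC ler_wpM2l ?rnorm_ge0//.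
by rewrite (le_trans (ler_norm _))// lerDl.
Qed.

(** A majorant in the real line replaces the sum of norms in the test for
absolute convergence. *)
Lemma cvg_rnorm_dominated (R : realType) (V : completeNormedModType R[i])
    (u : nat -> V) (t : nat -> R) :
  (forall n, t n <= 1) -> (forall n, rnorm (u n.+1 - u n) <= t n.+1 - t n) ->
  exists x : V, u @ \oo --> x.
Proof.
move=> t1 ut.
have utm m k : rnorm (u (m + k)%N - u m) <= t (m + k)%N - t m.
  elim: k => [|k IH]; first by rewrite addn0 !subrr rnorm0 lexx.
  rewrite addnS -(subrKA (u (m + k)%N)) (le_trans (ler_rnormD _ _))//.
  by rewrite -[leRHS](subrKA (t (m + k)%N)) lerD.
suff : cvgn u by move=> ?; exists (limn u).
apply/cauchy_cvgP/cauchy_exP => e; rewrite ltcE /= => /andP[/eqP e_im e0].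
have tsup : has_sup (range t).
  by split; [exists (t 0%N), 0%N|exists 1 => _ [n _ <-]].
have [_ [m _ <-] tm] := sup_adherent e0 tsup.
exists (u m), m => // n /= mn.
rewrite -ball_normE /= normE_rnorm -rnormN opprB.
have -> : e = (complex.Re e)%:C%C by case: e e_im {e0 tm} => ? ? /= ->.
rewrite ltcR -(subnKC mn) (le_lt_trans (utm _ _))// ltrBlDr.
rewrite addrC -ltrBlDr (le_lt_trans _ tm)// lerD2r.
by apply: ub_le_sup; [exact: tsup.2|exists (m + (n - m))%N].
Qed.

(** * Elementary facts on non-unital C*-algebras *)

Section CStarAlgebra.
Context {R : realType} {B : cstarAlgType R}.
Implicit Types (a b c x y z m : B).
Local Notation "a ** b" := (cmul a b) (at level 40, left associativity).

Lemma cmulr0 a : a ** 0 = 0.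
Proof. by apply: (addIr (a ** 0)); rewrite -cmulDr !add0r. Qed.

Lemma cmul0r a : 0 ** a = 0.
Proof. by apply: (addIr (0 ** a)); rewrite -cmulDl !add0r. Qed.

Lemma cmulrN a b : a ** (- b) = - (a ** b).
Proof. by apply: (addIr (a ** b)); rewrite -cmulDr !addNr cmulr0. Qed.

Lemma cmulNr a b : (- a) ** b = - (a ** b).
Proof. by apply: (addIr (a ** b)); rewrite -cmulDl !addNr cmul0r. Qed.

Lemma cmulBr a b c : a ** (b - c) = a ** b - a ** c.
Proof. by rewrite cmulDr cmulrN. Qed.

Lemma cmulBl a b c : (a - b) ** c = a ** c - b ** c.
Proof. by rewrite cmulDl cmulNr. Qed.

Lemma cstar0 : cstar 0 = 0 :> B.
Proof. by apply: (addIr (cstar 0)); rewrite -cstarD !add0r. Qed.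

Lemma cstarN a : cstar (- a) = - cstar a.
Proof. by apply: (addIr (cstar a)); rewrite -cstarD !addNr cstar0. Qed.

Lemma cstarB a b : cstar (a - b) = cstar a - cstar b.
Proof. by rewrite cstarD cstarN. Qed.

Lemma rnormM a b : rnorm (a ** b) <= rnorm a * rnorm b.
Proof. by rewrite -lecR rmorphM /= -!normE_rnorm cnormM. Qed.

Lemma rnorm_star_mul a : rnorm (cstar a ** a) = rnorm a ^+ 2.
Proof.
by apply: complexI; rewrite rmorphXn /= -!normE_rnorm cnorm_star_mul.
Qed.

Lemma rnorm_star a : rnorm (cstar a) = rnorm a.
Proof.
have le_star b : rnorm b <= rnorm (cstar b).
  have [->|b0] := eqVneq (rnorm b) 0; first exact: rnorm_ge0.
  rewrite -(@ler_pM2r _ (rnorm b)) ?lt_def ?b0 ?rnorm_ge0//.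
  by rewrite -expr2 -rnorm_star_mul rnormM.
by apply/le_anti; rewrite -{2}(cstarK a) !le_star.
Qed.

Lemma rnorm_selfadjoint_sqr c : cstar c = c -> rnorm (c ** c) = rnorm c ^+ 2.
Proof. by move=> {1}<-; rewrite rnorm_star_mul. Qed.

(** The next two closed sets are the ones to which the last clause of
[exists_quadratic_root] is applied. *)
Lemma closed_commutant b : closed [set z | z ** b = b ** z].
Proof.
have -> : [set z | z ** b = b ** z] = [set z | z ** b - b ** z = 0].
  by apply/seteqP; split=> z /= /eqP zb; apply/eqP; rewrite subr_eq0 in zb *.
apply: (@closed_bounded_kernel _ _ _ _ (rnorm b + rnorm b)) => [x y|x].
  by rewrite cmulBl cmulBr !opprB addrACA [RHS]addrACA; congr (_ + _);
    exact: addrC.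
rewrite (le_trans (ler_rnormB _ _))// mulrDl lerD ?rnormM//.
by rewrite mulrC rnormM.
Qed.

Lemma closed_selfadjoint : closed [set z : B | cstar z = z].
Proof.
have -> : [set z : B | cstar z = z] = [set z | cstar z - z = 0].
  by apply/seteqP; split=> z /= /eqP zb; apply/eqP; rewrite subr_eq0 in zb *.
apply: (@closed_bounded_kernel _ _ _ _ (1 + 1)) => [x y|x].
  by rewrite cstarB !opprB addrACA [RHS]addrACA; congr (_ + _);
    exact: addrC.
by rewrite (le_trans (ler_rnormB _ _))// rnorm_star mulrDl mul1r.
Qed.

(** * Square roots *)

Local Notation half := ((2^-1 : R)%:C%C).

Lemma half_double z : half *: (z + z) = z.
Proof.
have -> : z + z = (2%:R : R[i]) *: z by rewrite scaler_nat mulr2n.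
rewrite scalerA -(rmorph_nat (real_complex R)) -rmorphM /=.
by rewrite mulVf// scale1r.
Qed.

(** In the unitization 1 - y is the square root of 1 - x. It is the limit of
u_(n+1) = (x + u_n^2) / 2 from u_0 = 0. The coefficients being nonnegative, the
increments of u are bounded by those of the same iteration t for the number
x = 1, which increases and stays at most 1. The last clause transfers to y any
closed property that the iteration preserves, such as self-adjointness or
commutation with a given element. *)
Lemma exists_quadratic_root x : rnorm x <= 1 ->
  exists y, [/\ rnorm y <= 1, y + y = x + y ** y &
    forall S : set B, closed S -> S 0 ->
      (forall z, S z -> S (half *: (x + z ** z))) -> S y].
Proof.
move=> x1.
pose u := fix u n : B := if n is m.+1 then half *: (x + u m ** u m) else 0.
pose t := fix t n : R := if n is m.+1 then 2^-1 * (1 + t m ^+ 2) else 0.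
have half0 : 0 <= 2^-1 :> R by rewrite invr_ge0.
have t01 n : 0 <= t n <= 1.
  by elim: n => [|n /andP[IH0 IH1]] /=; [rewrite lexx ler01|nra].
have ut n : rnorm (u n) <= t n.
  elim: n => [|n IH] /=; first by rewrite rnorm0.
  rewrite rnormZr// ler_wpM2l// (le_trans (ler_rnormD _ _))// lerD//.
  by rewrite (le_trans (rnormM _ _))// expr2 ler_pM ?rnorm_ge0.
have sqrB y z : y ** y - z ** z = y ** (y - z) + (y - z) ** z.
  by rewrite cmulBr cmulBl subrKA.
have dut n : rnorm (u n.+1 - u n) <= t n.+1 - t n.
  elim: n => [|n IH]; first by rewrite !subr0; exact: ut.
  have -> : u n.+2 - u n.+1 = half *:
      (u n.+1 ** (u n.+1 - u n) + (u n.+1 - u n) ** u n).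
    by rewrite -sqrB -[u n.+2]/(half *: (x + u n.+1 ** u n.+1))
      -[X in _ - X]/(half *: (x + u n ** u n)) -scalerBr opprD addrACA
      subrr add0r.
  have -> : t n.+2 - t n.+1 = 2^-1 *
      (t n.+1 * (t n.+1 - t n) + (t n.+1 - t n) * t n).
    rewrite -[t n.+2]/(2^-1 * (1 + t n.+1 ^+ 2)).
    by rewrite -[X in _ - X = _]/(2^-1 * (1 + t n ^+ 2)); ring.
  rewrite rnormZr// ler_wpM2l// (le_trans (ler_rnormD _ _))// lerD//.
    by rewrite (le_trans (rnormM _ _))// ler_pM ?rnorm_ge0.
  by rewrite (le_trans (rnormM _ _))// ler_pM ?rnorm_ge0.
have [y uy] := cvg_rnorm_dominated (fun n => proj2 (andP (t01 n))) dut.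
have u1 n : rnorm (u n) <= 1.
  by rewrite (le_trans (ut n))//; case/andP: (t01 n).
have y1 : rnorm y <= 1.
  apply/ler_addgt0Pr => e e0.
  have [N /(_ N (leqnn N)) yN] := rnorm_cvgP uy e0.
  by rewrite -(subrK (u N) y) (le_trans (ler_rnormD _ _))// addrC lerD// ltW.
exists y; split => //.
- have -> : y + y = y + y - (x + y ** y) + (x + y ** y) by rewrite subrK.
  suff /rnorm0_eq0 -> : rnorm (y + y - (x + y ** y)) = 0 by rewrite add0r.
  apply/eqP; rewrite eq_le rnorm_ge0 andbT.
  apply/ler_addgt0Pr => e e0; rewrite add0r.
  have e4 : 0 < e / 4 by rewrite divr_gt0.
  have [N yN] := rnorm_cvgP uy e4.
  have uS : u N.+1 + u N.+1 = x + u N ** u N.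
    by rewrite -[RHS]half_double scalerDr.
  have -> : y + y - (x + y ** y) = (y - u N.+1) + (y - u N.+1) -
      (y ** (y - u N) + (y - u N) ** u N).
    rewrite -sqrB [in RHS]addrACA -opprD uS -[RHS]addrA -opprD.
    by rewrite [X in _ = _ - X]addrACA subrr addr0.
  rewrite (le_trans (ler_rnormB _ _))//.
  have := yN N (leqnn N); have := yN _ (leqnSn N).
  have := ler_rnormD (y - u N.+1) (y - u N.+1).
  have := ler_rnormD (y ** (y - u N)) ((y - u N) ** u N).
  have := rnormM y (y - u N); have := rnormM (y - u N) (u N).
  have := u1 N; have := rnorm_ge0 (y - u N).
  move: y1 e0; nra.
- move=> S clS S0 Sstep; apply: (@closed_cvg _ _ _ _ u S clS _ y uy).
  by apply: nearW => n; elim: n => //= n; exact: Sstep.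
Qed.

Lemma cstarZr (r : R) a : cstar (r%:C%C *: a) = r%:C%C *: cstar a.
Proof. by rewrite cstarZ; congr (_ *: _); exact: conjc_real. Qed.

Lemma cstarZi a : cstar ('i%C *: a) = - ('i%C *: cstar a).
Proof.
by rewrite cstarZ -scaleNr; congr (_ *: _); apply/eqP;
  rewrite eq_complex /= oppr0 !eqxx.
Qed.

(** * Quasi-unitary elements *)

(** If w z = z + w then (1 - w)(1 - z) = 1 in the unitization; here 1 - z and
1 - w are only used as operators of left multiplication. *)
Lemma quasi_unitary_cancel z w m : w ** z = z + w ->
  (m - z ** m) - w ** (m - z ** m) = m.
Proof.
move=> wz; rewrite cmulBr cmulA wz cmulDl opprB addrK.
by rewrite subrK.
Qed.

(** Here 1 - z has a left inverse that is its adjoint, so the C*-identity for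
(1 - z) m has m* m on its left-hand side. *)
Lemma quasi_unitary_isometry z m : cstar z ** z = z + cstar z ->
  rnorm (m - z ** m) = rnorm m.
Proof.
move=> zz; apply/eqP; rewrite -(@eqrXn2 _ 2%N) ?rnorm_ge0// -!rnorm_star_mul.
rewrite cstarB cstarM cmulBl -cmulA -cmulBr.
by rewrite quasi_unitary_cancel.
Qed.

(** For the unitary U = 1 - z with adjoint U' = 1 - w, the element on the left
is (U - U')(U + U') m = U^2 m - U'^2 m, and U and U' are isometric. *)
Lemma rnorm_quasi_unitary_double_sine z w m :
    cstar z = w -> w ** z = z + w -> z ** w = z + w ->
  rnorm ((w - z) ** ((m - z ** m) + (m - w ** m))) <= rnorm m + rnorm m.
Proof.
move=> zs wz zw; have ws : cstar w = z by rewrite -zs cstarK.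
pose v := (m - z ** m) + (m - w ** m); rewrite -/v.
have -> : (w - z) ** v = (m - z ** m - z ** (m - z ** m)) -
                         (m - w ** m - w ** (m - w ** m)).
  have E1 : v - z ** v = (m - z ** m - z ** (m - z ** m)) + m.
    rewrite /v cmulDr opprD addrACA; congr (_ + _).
    by rewrite quasi_unitary_cancel// zw addrC.
  have E2 : v - w ** v = (m - w ** m - w ** (m - w ** m)) + m.
    rewrite /v cmulDr opprD addrACA addrC; congr (_ + _).
    by rewrite quasi_unitary_cancel// wz.
  rewrite -[RHS]addr0 -(subrr m) -[RHS]addrACA -opprD -E1 -E2.
  by rewrite cmulBl opprB [RHS]addrC addrA subrK.
rewrite (le_trans (ler_rnormB _ _))// lerD//.
  by rewrite !quasi_unitary_isometry// zs.
by rewrite !quasi_unitary_isometry// ws zw addrC.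
Qed.

(** With k the square root of 1 - c^2, the claim is that x = (2 c k)^2 has norm
at most 1. The element U = k + i c is unitary, with adjoint U' = k - i c, and
U^2 - U'^2 = 4 i c k, so ||4 c k m|| <= 2 ||m|| for all m; taking m = c k, which
is self-adjoint, gives ||c k|| <= 1/2. *)
Lemma rnorm_double_angle c b : cstar c = c -> rnorm c <= 1 ->
  b = c ** c + c ** c -> rnorm (b + b - b ** b) <= 1.
Proof.
move=> cs c1 ->.
have cc1 : rnorm (c ** c) <= 1.
  by rewrite rnorm_selfadjoint_sqr// expr_le1 ?rnorm_ge0.
have [y [_ yE yS]] := exists_quadratic_root cc1.
have yc : [set z | z ** c = c ** z] y.
  apply: (yS _ (@closed_commutant c)) => [|z /= zc].
    by rewrite /= cmulr0 cmul0r.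
  rewrite -cscaleAl -cscaleAr cmulDl cmulDr; congr (_ *: (_ + _)).
    by rewrite cmulA.
  by rewrite -cmulA zc !cmulA zc.
rewrite /= in yc.
have ys : [set z | cstar z = z] y.
  apply: (yS _ (@closed_selfadjoint)) => [|z /= zs]; first exact: cstar0.
  by rewrite cstarZr cstarD !cstarM zs cs.
rewrite /= in ys.
(* k = 1 - y, so that U = 1 - z and U' = 1 - w. *)
pose z := y - 'i%C *: c; pose w := y + 'i%C *: c.
have zs : cstar z = w.
  by rewrite cstarB cstarZi ys cs opprK.
have ws : cstar w = z by rewrite -zs cstarK.
have zw : z + w = y + y by rewrite addrACA addNr addr0.
have wz_prod : w ** z = y + y.
  rewrite cmulBr !cmulDl -!cscaleAl -!cscaleAr yc scalerA -expr2 sqr_i.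
  by rewrite scaleN1r opprD opprK addrA addrK yE addrC.
have zw_prod : z ** w = y + y.
  rewrite cmulDr !cmulBl -!cscaleAl -!cscaleAr yc scalerA -expr2 sqr_i.
  by rewrite scaleN1r opprK addrA subrK yE addrC.
(* s is the product c k. *)
pose s := c - c ** y.
have ss : cstar s = s by rewrite cstarB cstarM ys cs yc.
have D_ss : s ** s = c ** c - (c ** c) ** (c ** c).
  have cycy : c ** y ** (c ** y) = c ** c ** (y ** y).
    by rewrite -!cmulA; congr (_ ** _); rewrite !cmulA yc.
  rewrite cmulBl !cmulBr cycy -cmulA yc cmulA opprB addrA.
  rewrite -[c ** c ** (c ** c)](addrK (c ** c ** (y ** y))) -cmulDr -yE cmulDr.
  by rewrite !opprD opprK addrA addrAC [in RHS]addrA.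
have sE : s ** s = c ** (s - y ** s).
  by rewrite cmulBr {1}/s cmulBl cmulA.
pose v := (s - z ** s) + (s - w ** s).
have vE : v = (s - y ** s) *+ 2.
  rewrite /v addrACA -opprD -cmulDl zw cmulDl mulr2n.
  by rewrite [in RHS]addrACA -opprD.
have wzv : (w - z) ** v = 'i%C *: (s ** s) *+ 4.
  have -> : w - z = ('i%C *: c) *+ 2.
    by rewrite /w /z opprB addrC addrA subrK mulr2n.
  rewrite sE vE; move: (s - y ** s) => t.
  by rewrite !mulr2n cmulDl !cmulDr -!cscaleAl -!mulr2n -mulrnA.
have le_v : rnorm ((w - z) ** v) <= rnorm s + rnorm s.
  by apply: rnorm_quasi_unitary_double_sine; rewrite ?zs ?zw.
have s_half : rnorm s *+ 2 <= 1.
  move: le_v; rewrite wzv rnormMn rnormZi rnorm_selfadjoint_sqr//.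
  by have := rnorm_ge0 s; nra.
have -> : c ** c + c ** c + (c ** c + c ** c) -
    (c ** c + c ** c) ** (c ** c + c ** c) = (s ** s) *+ 4.
  rewrite D_ss cmulDl !cmulDr -!mulr2n -!mulrnA.
  by rewrite mulrnBl.
rewrite rnormMn rnorm_selfadjoint_sqr//.
by have := rnorm_ge0 s; nra.
Qed.

(** * Essential ideals *)

Lemma closed_left_annihilator a :
  closed [set b : B | b ** a = 0].
Proof.
apply: (@closed_bounded_kernel _ _ _ (fun b => b ** a) (rnorm a)) => [x y|x].
  exact: cmulBl.
by rewrite mulrC rnormM.
Qed.

(** The left annihilator J of I is a closed ideal, stable under multiplication
on the right because I is a left ideal. It meets I in 0: if a lies in both, then
a a* = 0. *)
Lemma essential_ideal_faithful (I : set B) : essential_ideal I ->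
  (forall a, I a -> I (cstar a)) ->
  forall q, (forall a, I a -> q ** a = 0) -> q = 0.
Proof.
move=> [Iideal Iess] Istar q q0.
pose J := \bigcap_(a in I) [set b : B | b ** a = 0].
have Jideal : closed_ideal J.
  split.
  - by move=> a _; rewrite /= cmul0r.
  - by move=> b c Jb Jc a Ia; rewrite /= cmulDl (Jb a Ia) (Jc a Ia) addr0.
  - by move=> k b Jb a Ia; rewrite /= -cscaleAl (Jb a Ia) scaler0.
  - by move=> c b Jb a Ia; rewrite /= -cmulA (Jb a Ia) cmulr0.
  - move=> b c Jb a Ia; rewrite /= -cmulA.
    by apply: Jb; apply: closed_idealMl Ia.
  - by apply: closed_bigI => a _; exact: closed_left_annihilator.
have [J0|/(Iess J Jideal)/eqP[]] := eqVneq J [set 0].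
  by have : J q by []; rewrite J0.
apply/seteqP; split=> [a [Ia Ja]|_ ->]; last first.
  by split; [exact: closed_ideal0 Iideal|exact: closed_ideal0 Jideal].
apply: rnorm0_eq0; apply/eqP; rewrite -rnorm_star -sqrf_eq0 -rnorm_star_mul.
by rewrite cstarK (Ja _ (Istar _ Ia)) rnorm0.
Qed.

Section EssentialIdeal.
Variable I : set B.
Hypothesis Iess : essential_ideal I.
Hypothesis Istar : forall a, I a -> I (cstar a).

(** Let b = 2 c^2 and y = 1 - |1 - b|. The identity 2 (b - y) = (b - y)(b + y)
can be iterated: on I, multiplication by (b + y) / 2 contracts by the factor
k = (1 + r) / 2 < 1, so b - y annihilates I. *)
Lemma cutoff_rnorm_le1 c r : cstar c = c -> rnorm c <= 1 -> 0 <= r < 1 ->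
  (forall a, I a -> rnorm ((c ** c + c ** c) ** a) <= r * rnorm a) ->
  rnorm (c ** c + c ** c) <= 1.
Proof.
move=> cs c1 /andP[r0 r1].
have := rnorm_double_angle cs c1 erefl.
move: (c ** c + c ** c) => b x1 br.
have [y [y1 yE yS]] := exists_quadratic_root x1.
have yb : [set z | z ** b = b ** z] y.
  apply: (yS _ (@closed_commutant b)) => [|z /= zb].
    by rewrite /= cmulr0 cmul0r.
  rewrite -cscaleAl -cscaleAr; congr (_ *: _).
  by rewrite !(cmulDl, cmulDr, cmulBl, cmulBr) -!cmulA zb !cmulA zb.
rewrite /= in yb.
pose q := b - y.
have qq : q ** (b + y) = q + q.
  rewrite cmulDr !cmulBl yb addrA subrK.
  rewrite -[y ** y](addrK (b + b - b ** b)) [_ + (b + b - _)]addrC -yE.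
  by rewrite opprB addrA [b ** b + _]addrC subrK [RHS]addrACA -opprD.
suff q0 : q = 0.
  by move/eqP: q0; rewrite subr_eq0 => /eqP ->.
apply: essential_ideal_faithful Iess Istar _ _ => a Ia.
pose k := (1 + r) / 2.
have k0 : 0 <= k by rewrite /k; lra.
have k1 : `|k| < 1 by rewrite ger0_norm // /k; lra.
have qn n a' : I a' -> rnorm (q ** a') <= rnorm q * k ^+ n * rnorm a'.
  elim: n a' => [|n IH] a' Ia'; first by rewrite mulr1 rnormM.
  have Iba : I ((b + y) ** a') by apply: closed_idealMl Ia'; exact: Iess.1.
  have := IH _ Iba; rewrite cmulA qq cmulDl -mulr2n rnormMn => qa.
  have bya : rnorm ((b + y) ** a') <= (1 + r) * rnorm a'.
    rewrite cmulDl (le_trans (ler_rnormD _ _))// mulrDl mul1r addrC lerD ?br//.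
    rewrite (le_trans (rnormM _ _))// ler_piMl ?rnorm_ge0//.
  have qk : 0 <= rnorm q * k ^+ n by rewrite mulr_ge0 ?rnorm_ge0 ?exprn_ge0.
  have := ler_wpM2l qk bya.
  by rewrite exprSr /k; lra.
apply: rnorm0_eq0; apply/eqP; rewrite eq_le rnorm_ge0 andbT.
have kcvg : rnorm q * k ^+ n * rnorm a @[n --> \oo] --> rnorm q * 0 * rnorm a.
  by apply: cvgMl; apply: cvgMr; exact: cvg_expr.
rewrite mulr0 mul0r in kcvg.
rewrite -(cvg_lim _ kcvg)//.
apply: limr_ge; first by apply/cvg_ex; exists 0.
by apply: nearW => n; exact: qn.
Qed.

(** Scaling c^2 by t = 1 / (r + N) with N = ||c^2|| puts 1 strictly between the
bounds 2 t r and 2 t N while keeping 2 t N at most 2, which is what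
[cutoff_rnorm_le1] needs to rule out r < N. *)
Lemma rnorm_sqr_le_ideal_bound c r : cstar c = c -> 0 <= r ->
  (forall a, I a -> rnorm (c ** c ** a) <= r * rnorm a) ->
  rnorm (c ** c) <= r.
Proof.
move=> cs r0 cr; rewrite leNgt; apply/negP => rN.
set N := rnorm (c ** c) in rN.
have N0 : 0 < r + N by lra.
pose t := (r + N)^-1.
have t0 : 0 <= t by rewrite invr_ge0 ltW.
have tE : t * (r + N) = 1 by rewrite mulVf// gt_eqF.
pose d := (Num.sqrt t)%:C%C *: c.
have dd : d ** d = t%:C%C *: (c ** c).
  by rewrite -cscaleAl -cscaleAr scalerA -rmorphM /= -expr2 sqr_sqrtr.
have ds : cstar d = d by rewrite cstarZr cs.
have d1 : rnorm d <= 1.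
  rewrite -(@expr_le1 _ 2%N) ?rnorm_ge0// -rnorm_selfadjoint_sqr//.
  by rewrite dd rnormZr// -/N; nra.
have : rnorm (d ** d + d ** d) <= 1.
  apply: (@cutoff_rnorm_le1 d (t * r *+ 2)) => // [|a Ia].
    by apply/andP; split; nra.
  rewrite cmulDl -mulr2n rnormMn dd -cscaleAl rnormZr//.
  by have := ler_wpM2l t0 (cr a Ia); lra.
rewrite -mulr2n rnormMn dd rnormZr// -/N; nra.
Qed.

(** Apply the previous lemma to h = b* b: the factors to the left of the last
b in h^2 = b* b b* b only cost ||b||^3, while ||h^2|| = ||b||^4. *)
Lemma rnorm_le_ideal_bound b r : 0 <= r ->
  (forall a, I a -> rnorm (b ** a) <= r * rnorm a) -> rnorm b <= r.
Proof.
move=> r0 br.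
have [->//|b0] := eqVneq (rnorm b) 0.
have {}b0 : 0 < rnorm b by rewrite lt_def b0 rnorm_ge0.
pose h := cstar b ** b.
have hs : cstar h = h by rewrite cstarM cstarK.
have : rnorm (h ** h) <= rnorm b ^+ 3 * r.
  apply: rnorm_sqr_le_ideal_bound => // [|a Ia].
    by rewrite mulr_ge0// exprn_ge0// ltW.
  rewrite /h -!cmulA (le_trans (rnormM _ _))// rnorm_star.
  rewrite (le_trans (ler_wpM2l (ltW b0) (rnormM _ _)))//.
  rewrite !exprS expr0 mulr1 -!mulrA ler_wpM2l ?(ltW b0)//.
  rewrite ler_wpM2l ?(ltW b0)//.
  rewrite (le_trans (rnormM _ _))// rnorm_star ler_wpM2l ?(ltW b0)//.
  exact: br.
rewrite rnorm_selfadjoint_sqr// rnorm_star_mul -exprM -[(2 * 2)%N]/3.+1%N.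
rewrite exprSr.
by rewrite ler_pM2l// exprn_gt0.
Qed.

End EssentialIdeal.
End CStarAlgebra.

(** * Hilbert modules and the theorem *)

Lemma rnorm_hdot (R : realType) (B : cstarAlgType R) (W : hilbertModType B)
  (y : W) : rnorm (hdot y y) = rnorm y ^+ 2.
Proof.
by apply: complexI; rewrite rmorphXn /= -!normE_rnorm hnormE sqrtCK.
Qed.

Lemma hdot_ractl (R : realType) (B : cstarAlgType R) (W : hilbertModType B)
  (x y : W) (a : B) : hdot (ract x a) y = cmul (cstar a) (hdot x y).
Proof. by rewrite -hdot_star hdot_ract cstarM hdot_star. Qed.

(** Take c with <y, y> = c* c; then <ya, ya> = a* <y, y> a = (ca)* (ca). *)
Lemma hilbert_norm_by_algebra (R : realType) (B : cstarAlgType R)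
    (W : hilbertModType B) (y : W) :
  exists c : B, rnorm y = rnorm c /\
    forall a, rnorm (ract y a) = rnorm (cmul c a).
Proof.
have [c yc] := hdot_ge0 y; exists c; split=> [|a]; apply/eqP;
  rewrite -(@eqrXn2 _ 2%N) ?rnorm_ge0// -rnorm_star_mul -rnorm_hdot.
  by rewrite yc.
by rewrite hdot_ract hdot_ractl yc cstarM !cmulA.
Qed.

Theorem theorem4p2 (R : realType) (A : cstarAlgType R) (V : hilbertModType A)
    (B : cstarAlgType R) (iota : A -> B) (W : hilbertModType B) (Phi : V -> W)
    (hext : is_essential_extension iota Phi) :
  (forall b : B, rnorm b =
     sup [set rnorm (cmul b (iota a)) | a in [set a : A | rnorm a <= 1]]) /\
  (forall y : W, rnorm y =
     sup [set rnorm (ract y (iota a)) | a in [set a : A | rnorm a <= 1]]).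
Proof.
case: hext => -[[iotaL _ iota_star iota_norm] _ _ _] Iess.
have rnorm_iota a : rnorm (iota a) = rnorm a by rewrite /rnorm iota_norm.
have iotaZ k a : iota (k *: a) = k *: iota a.
  have iota0 : iota 0 = 0 by apply: rnorm0_eq0; rewrite rnorm_iota rnorm0.
  by have := iotaL k a 0; rewrite iota0 !addr0.
have Istar b : range iota b -> range iota (cstar b).
  by move=> [a _ <-]; exists (cstar a).
have normB (b : B) : rnorm b =
    sup [set rnorm (cmul b (iota a)) | a in [set a : A | rnorm a <= 1]].
  set S := [set _ | _ in _].
  have S0 : S 0.
    exists 0; rewrite /= ?rnorm0 ?ler01//.
    by apply/le_anti; rewrite rnorm_ge0 andbT (le_trans (rnormM _ _))//
      rnorm_iota rnorm0 mulr0.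
  have Sub : ubound S (rnorm b).
    move=> _ [a /= a1 <-]; rewrite (le_trans (rnormM _ _))// rnorm_iota.
    by rewrite ler_piMr ?rnorm_ge0.
  have Sle : ubound S (sup S) by apply: ub_le_sup; exists (rnorm b).
  apply/le_anti; rewrite ge_sup ?andbT//; last by exists 0.
  apply: (rnorm_le_ideal_bound Iess Istar); first exact: Sle.
  move=> _ [a _ <-]; rewrite rnorm_iota.
  have [/rnorm0_eq0 ->|a0] := eqVneq (rnorm a) 0.
    by rewrite rnorm0 mulr0 (le_trans (rnormM _ _))// rnorm_iota rnorm0 mulr0.
  have {}a0 : 0 < rnorm a by rewrite lt_def a0 rnorm_ge0.
  have ai0 : 0 <= (rnorm a)^-1 by rewrite invr_ge0 ltW.
  rewrite -ler_pdivrMr// mulrC -rnormZr// cscaleAr -iotaZ.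
  apply: Sle; exists ((rnorm a)^-1%:C%C *: a); rewrite //=.
  by rewrite rnormZr// mulVf ?gt_eqF.
split=> // y; have [c [-> yc]] := hilbert_norm_by_algebra y.
rewrite normB; congr (sup _); apply: eq_imagel => a _.
by rewrite yc.
Qed.
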